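(* Let $P$ be a finite poset in which each element covers at most two elements and is covered by at most two elements, and such that $J(P)$ is tCDE with edge density $\delta$. Fix $\alpha^{\mathrm{B}},\omega^{\mathrm{B}}\in\mathbb{R}_{>0}$ and let $\mathcal{O}$ be a finite orbit of $\mathrm{row}^{\mathrm{B}}\colon\mathbb{R}_{>0}^P\to\mathbb{R}_{>0}^P$. Then \[\prod_{f\in\mathcal{O}}\mathrm{ddeg}^{\mathrm{B}}(f)=\left(\frac{\omega^{\mathrm{B}}}{\alpha^{\mathrm{B}}}\right)^{\delta\cdot\#\mathcal{O}}.\]
   Context: $J(P)$ is the set of order ideals of $P$; $\mathrm{ddeg}(I)$ is the number of maximal elements of $I$. Toggle: $\tau_p(I)=I\cup\{p\}$ if $p\notin I$ and $I\cup\{p\}\in J(P)$; $I\setminus\{p\}$ if $p\in I$ and $I\setminus\{p\}\in J(P)$; $I$ otherwise. $\mathcal{T}_p(I)$ is $1$ if $I\subsetneq\tau_p(I)$, $-1$ if $\tau_p(I)\subsetneq I$, $0$ otherwise. A distribution $\mu$ on $J(P)$ is toggle-symmetric if $\mathbb{E}_\mu[\mathcal{T}_p]=0$ for all $p$; the edge density is the uniform average of $\mathrm{ddeg}$ on $J(P)$; $J(P)$ is tCDE if $\mathbb{E}_\mu[\mathrm{ddeg}]$ equals the edge density for all toggle-symmetric $\mu$. Let $\widehat P$ be $P$ with a new minimum $\widehat0$ and maximum $\widehat1$; each $f\in\mathbb{R}_{>0}^P$ is regarded as a function on $\widehat P$ with $f(\widehat0)=\alpha^{\mathrm{B}}$,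 $f(\widehat1)=\omega^{\mathrm{B}}$. The birational toggle $\tau^{\mathrm{B}}_p$ leaves $f(q)$ unchanged for $q\neq p$ and replaces $f(p)$ by $\dfrac{1}{f(p)}\cdot\dfrac{\sum_{x\in\widehat P:\,p\text{ covers }x}f(x)}{\sum_{x\in\widehat P:\,x\text{ covers }p}1/f(x)}$; $\mathrm{row}^{\mathrm{B}}=\tau^{\mathrm{B}}_{p_1}\circ\cdots\circ\tau^{\mathrm{B}}_{p_N}$ for any linear extension $p_1,\ldots,p_N$ of $P$. Define $\mathcal{T}^{\mathrm{B}}_{p^-}(f)=\dfrac{1}{f(p)}\cdot\dfrac{1}{\sum_{q\in\widehat P:\,q\text{ covers }p}1/f(q)}$ and $\mathrm{ddeg}^{\mathrm{B}}=\prod_{p\in P}\mathcal{T}^{\mathrm{B}}_{p^-}$. Non-integral powers of positive reals are principal roots. *)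

(* Defs.v *)
From HB Require Import structures.
From mathcomp Require Import all_boot all_order all_algebra finmap.
From mathcomp Require Import mathcomp_extra boolp classical_sets cardinality.
From mathcomp Require Import reals exp.

Set Implicit Arguments.
Unset Strict Implicit.
Unset Printing Implicit Defensive.

Import Order.TTheory GRing.Theory Num.Theory.

Local Open Scope ring_scope.

Definition covers (d : Order.disp_t) (T : finPOrderType d) (y x : T) : bool :=
  (x < y)%O && ~~ [exists z : T, (x < z)%O && (z < y)%O].

Section OrderIdeals.
Variables (d : Order.disp_t) (P : finPOrderType d).
Implicit Types (I : {set P}) (p : P).

Definition is_ideal I : bool :=
  [forall x in I, forall y : P, (y <= x)%O ==> (y \in I)].

Definition ideals : {set {set P}} := [set I | is_ideal I].

Definition ddeg I : nat := #|[set p in I | [forall q in I, ~~ (p < q)%O]]|.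

Definition toggle p I : {set P} :=
  if (p \notin I) && (p |: I \in ideals) then p |: I
  else if (p \in I) && (I :\ p \in ideals) then I :\ p
  else I.

End OrderIdeals.

Section ToggleSymmetry.
Variables (R : realType) (d : Order.disp_t) (P : finPOrderType d).

Definition toggleability (p : P) (I : {set P}) : R :=
  if I \proper toggle p I then 1
  else if toggle p I \proper I then -1
  else 0.

(* Only the values of a distribution on the order ideals are ever used. *)
Definition is_distribution (mu : {set P} -> R) : Prop :=
  (forall I, I \in ideals P -> 0 <= mu I) /\ \sum_(I in ideals P) mu I = 1.

Definition expectation (mu X : {set P} -> R) : R :=
  \sum_(I in ideals P) mu I * X I.

Definition toggle_symmetric (mu : {set P} -> R) : Prop :=
  forall p : P, expectation mu (toggleability p) = 0.

Definition edge_density : R :=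
  (\sum_(I in ideals P) (ddeg I)%:R) / #|ideals P|%:R.

Definition tCDE : Prop :=
  forall mu : {set P} -> R, is_distribution mu -> toggle_symmetric mu ->
    expectation mu (fun I => (ddeg I)%:R) = edge_density.

End ToggleSymmetry.

Variant hat (T : Type) : Type := HBot | HElt of T | HTop.
Arguments HBot {T}.
Arguments HTop {T}.

Definition hat_to_opt (T : Type) (x : hat T) : option (option T) :=
  match x with HBot => None | HElt p => Some (Some p) | HTop => Some None end.

Definition opt_to_hat (T : Type) (x : option (option T)) : hat T :=
  match x with None => HBot | Some (Some p) => HElt p | Some None => HTop end.

Lemma hat_to_optK (T : Type) : cancel (@hat_to_opt T) (@opt_to_hat T).
Proof. by case. Qed.

HB.instance Definition _ (T : finType) :=
  Finite.copy (hat T) (can_type (@hat_to_optK T)).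

Section HatOrder.
Variables (d : Order.disp_t) (P : finPOrderType d).

Definition hat_le (x y : hat P) : bool :=
  match x, y with
  | HBot, _ | _, HTop => true
  | HElt p, HElt q => (p <= q)%O
  | _, _ => false
  end.

Lemma hat_le_refl : reflexive hat_le.
Proof. by case=> //= p; exact: lexx. Qed.

Lemma hat_le_anti : antisymmetric hat_le.
Proof. by case=> [|p|] [|q|] //= /le_anti ->. Qed.

Lemma hat_le_trans : transitive hat_le.
Proof. by case=> [|q|] [|p|] [|r|] //=; exact: le_trans. Qed.

HB.instance Definition _ :=
  Order.Le_isPOrder.Build d (hat P) hat_le_refl hat_le_anti hat_le_trans.

End HatOrder.

Section Birational.
Variables (R : realType) (d : Order.disp_t) (P : finPOrderType d).
Variables (alpha omega : R).
Implicit Types (f : {ffun P -> R}) (p : P).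

Definition positive_functions : set {ffun P -> R} :=
  [set f | forall p : P, 0 < f p]%classic.

Definition hat_ext f (x : hat P) : R :=
  match x with HBot => alpha | HElt p => f p | HTop => omega end.

Definition toggleB p f : {ffun P -> R} :=
  [ffun q => if q == p then
     (f p)^-1 *
     ((\sum_(x : hat P | covers (HElt p) x) hat_ext f x) /
      (\sum_(x : hat P | covers x (HElt p)) (hat_ext f x)^-1))
   else f q].

Definition linear_extension (s : seq P) : Prop :=
  [/\ uniq s, (forall p : P, p \in s) &
      forall p q : P, (p < q)%O -> (index p s < index q s)%N].

(* For s = [:: p_1; ...; p_N] this is toggleB p_1 \o ... \o toggleB p_N, so
   that p_N is toggled first. *)
Definition rowB (s : seq P) f : {ffun P -> R} := foldr toggleB f s.

Definition toggleabilityB_minus p f : R :=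
  (f p)^-1 * (\sum_(q : hat P | covers q (HElt p)) (hat_ext f q)^-1)^-1.

Definition ddegB f : R := \prod_(p : P) toggleabilityB_minus p f.

End Birational.

(* The two-sided orbit of x under phi acting on D: for phi bijective on D this
   is the set of all phi^k x with k an integer. *)
Definition orbit_on (T : Type) (D : set T) (phi : T -> T) (x : T) : set T :=
  [set y | D y /\ exists n : nat, y = iter n phi x \/ x = iter n phi y]%classic.

Definition is_orbit (T : Type) (D : set T) (phi : T -> T) (O : set T) : Prop :=
  exists2 x, D x & O = orbit_on D phi x.

(* Main.v *)
Require Import Defs.
From HB Require Import structures.
From mathcomp Require Import all_boot all_order all_algebra finmap.
From mathcomp Require Import mathcomp_extra boolp classical_sets cardinality.
From mathcomp Require Import reals exp.
From mathcomp Require Import ring lra fintype finset.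

Set Implicit Arguments.
Unset Strict Implicit.
Unset Printing Implicit Defensive.

Import Order.TTheory GRing.Theory Num.Theory.

Local Open Scope ring_scope.

(** To a positive [f] one attaches a signed measure [w] on order ideals such that
    the mass of the ideals containing [I] is [ln omega - ln (\sum f)], the sum
    being over the maximal elements of [I] (and [alpha] if [I] is empty); it
    exists by Moebius inversion.  By inclusion-exclusion the [w]-expectations of
    the two toggleability indicators at [p] are the logarithms of their birational
    analogues at [f]; for removability this is where at most two upper covers are
    needed.  The birational identity T^-_p(row f) = T^+_p(f) makes the sum of these
    measures over a finite orbit toggle-symmetric.  A toggle-symmetric signed
    measure is a combination of toggle-symmetric distributions, so tCDE applies to
    it and gives the logarithm of the claim. *)

(** * Order ideals, covers and combinatorial toggles *)

Section Ideals.
Variables (d : Order.disp_t) (P : finPOrderType d).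
Implicit Types (p q : P) (I J : {set P}).

Lemma idealP I :
  reflect (forall x y : P, x \in I -> (y <= x)%O -> y \in I) (I \in ideals P).
Proof.
rewrite inE; apply: (iffP forall_inP) => [h x y xI yx|h x xI].
  by have /forallP/(_ y)/implyP := h x xI; apply.
by apply/forallP => y; apply/implyP; apply: h xI.
Qed.

Definition maximals I : {set P} :=
  [set p in I | [forall q in I, ~~ (p < q)%O]]%SET.

Definition down p : {set P} := [set q | (q <= p)%O]%SET.
Definition sdown p : {set P} := [set q | (q < p)%O]%SET.

Lemma down_ideal p : down p \in ideals P.
Proof. by apply/idealP => x y; rewrite !inE => xp yx; exact: le_trans xp. Qed.

Lemma sdown_ideal p : sdown p \in ideals P.
Proof. by apply/idealP => x y; rewrite !inE => xp yx; exact: le_lt_trans xp. Qed.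

Lemma setU_ideal I J : I \in ideals P -> J \in ideals P -> (I :|: J)%SET \in ideals P.
Proof.
move=> /idealP hI /idealP hJ; apply/idealP => x y; rewrite !inE.
by case/orP => [/hI h /h ->//|/hJ h /h ->]; rewrite orbT.
Qed.

Lemma set0_ideal : (set0 : {set P}) \in ideals P.
Proof. by apply/idealP => x y; rewrite inE. Qed.

Lemma down_subE p J : J \in ideals P -> (down p \subset J) = (p \in J).
Proof.
move=> /idealP hJ; apply/subsetP/idP => [->//|pJ x]; first by rewrite inE.
by rewrite inE; exact: hJ.
Qed.

Lemma maximals_down p : maximals (down p) = [set p]%SET.
Proof.
apply/setP => x; rewrite !inE; apply/andP/eqP => [[xp /forall_inP/(_ p)]|->].
  by rewrite inE lexx => /(_ isT); rewrite lt_neqAle xp andbT negbK => /eqP.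
by rewrite lexx; split=> //; apply/forall_inP => q; rewrite inE => /le_gtF ->.
Qed.

Lemma maximals_sdown p : maximals (sdown p) = [set q | covers p q]%SET.
Proof.
apply/setP => x; rewrite !inE /covers; congr (_ && _).
rewrite negb_exists; apply: eq_forallb => z.
by rewrite inE negb_and orbC implybE.
Qed.

(** Among the elements of the interval from [p] (excluded) to [q], one with the smallest principal
    ideal has nothing strictly between it and [p]. *)
Lemma exists_upper_cover p q :
  (p < q)%O -> exists2 r, covers r p & (r <= q)%O.
Proof.
move=> pq; have pq' : (p < q <= q)%O by rewrite pq lexx.
case: (@arg_minnP _ q (fun r => (p < r <= q)%O) (fun r => #|down r|) pq')
  => r /andP[pr rq] rmin.
exists r => //; rewrite /covers pr /=; apply/negP => /existsP[z /andP[pz zr]].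
have := rmin z; rewrite pz (le_trans (ltW zr) rq) => /(_ isT).
rewrite leqNgt => /negP; apply; apply: proper_card.
apply/properP; split; last by exists r; rewrite !inE ?lexx // lt_geF.
by apply/subsetP => x; rewrite !inE => /le_trans; apply; exact: ltW.
Qed.

Lemma exists_lower_cover p q : (q < p)%O -> exists r, covers p r.
Proof.
move=> qp.
case: (@arg_maxnP _ q (fun r => (r < p)%O) (fun r => #|down r|) qp) => r rp rmax.
exists r; rewrite /covers rp /=; apply/negP => /existsP[z /andP[rz zp]].
have : (#|down z| <= #|down r|)%N := rmax z zp.
rewrite leqNgt => /negP; apply; apply: proper_card.
apply/properP; split; last by exists z; rewrite !inE ?lexx // lt_geF.
by apply/subsetP => x; rewrite !inE => /le_trans; apply; exact: ltW.
Qed.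

Lemma upper_covers_antichain p q r :
  covers q p -> covers r p -> (q <= r)%O -> q = r.
Proof.
move=> /andP[pq _] /andP[_ /existsPn/(_ q)]; rewrite pq /=.
by rewrite lt_neqAle negb_and negbK => /orP[/eqP//|/negbTE ->].
Qed.

(** Upper covers of one element form an antichain, so neither generator lies strictly below an
    element of the other's ideal. This evaluates the intersection term of inclusion-exclusion in
    [expectation_removable]. *)
Lemma maximals_downU p q r : covers q p -> covers r p ->
  maximals (down q :|: down r)%SET = [set q; r]%SET.
Proof.
move=> qp rp; apply/setP => x; rewrite !inE; apply/andP/orP.
  case=> xqr /forall_inP h; have hq := h q; have hr := h r; move: hq hr.
  rewrite !inE !lexx orbT => /(_ isT) hq /(_ isT) hr.
  case/orP: xqr => xle; [left; move: hq|right; move: hr].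
    by rewrite lt_neqAle xle andbT negbK.
  by rewrite lt_neqAle xle andbT negbK.
have aux a b z : covers a p -> covers b p -> (z <= b)%O -> (a < z)%O -> False.
  move=> ap bp zb az; have ab := upper_covers_antichain ap bp (ltW (lt_le_trans az zb)).
  by move: az; rewrite ab (le_gtF zb).
case=> /eqP ->; rewrite lexx ?orbT; split=> //; apply/forall_inP => z;
  rewrite !inE => /orP[] zle; apply/negP.
- exact: aux zle.
- exact: aux zle.
- exact: aux zle.
- exact: aux zle.
Qed.

(** [addable] and [removable] split toggleability into its positive and negative parts, each of
    which has its own birational analogue. *)
Definition addable p I : bool := (p \notin I) && (sdown p \subset I).

Definition removable p I : bool := (p \in I) && [forall q in I, ~~ (p < q)%O].

Lemma setU1_ideal p I : I \in ideals P -> p \notin I ->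
  ((p |: I)%SET \in ideals P) = (sdown p \subset I).
Proof.
move=> /idealP hI pI; apply/idealP/subsetP => [h x|h x y].
  rewrite inE => xp; have := h p x; rewrite !inE eqxx => /(_ isT (ltW xp)).
  by rewrite (lt_eqF xp).
rewrite !inE => /orP[/eqP -> |xI yx]; last by rewrite (hI x) ?orbT.
by rewrite le_eqVlt => /orP[->//|yp]; rewrite h ?orbT // inE.
Qed.

Lemma setD1_ideal p I : I \in ideals P -> p \in I ->
  ((I :\ p)%SET \in ideals P) = [forall q in I, ~~ (p < q)%O].
Proof.
move=> /idealP hI pI; apply/idealP/forall_inP => [h x xI|h x y].
  apply/negP => px; have := h x p; rewrite !inE eqxx xI (gt_eqF px) /=.
  by move=> /(_ isT (ltW px)).
rewrite !inE => /andP[xp xI] yx; rewrite (hI x y) // andbT.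
apply: contra (h x xI) => /eqP yp; rewrite -yp lt_neqAle yx andbT yp.
by rewrite eq_sym.
Qed.

Lemma toggle_ideal p I : I \in ideals P -> toggle p I \in ideals P.
Proof.
move=> hI; rewrite /toggle; case: ifP => [/andP[]//|_].
by case: ifP => [/andP[]|].
Qed.

Lemma toggleK p I : I \in ideals P -> toggle p (toggle p I) = I.
Proof.
move=> hI; rewrite {2}/toggle; case: ifP => [/andP[pI pIi]|h1].
  by rewrite /toggle setU11 /= setU1K // hI.
case: ifP => [/andP[pI pIi]|h2]; last by rewrite /toggle h1 h2.
by rewrite /toggle setD11 /= setD1K // hI.
Qed.

Variable R : realType.

Lemma toggleabilityE p I : I \in ideals P ->
  toggleability R p I = (addable p I)%:R - (removable p I)%:R.
Proof.
move=> hI; rewrite /toggleability /addable /removable /toggle.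
case: (boolP (p \in I)) => pI /=; rewrite ?sub0r ?subr0.
  rewrite setD1_ideal //; case: [forall q in I, _]; last by rewrite properxx oppr0.
  rewrite properD1 //; case: ifP => // /(proper_trans (properD1 pI)).
  by rewrite properxx.
rewrite setU1_ideal //; case: (_ \subset _); last by rewrite properxx.
by rewrite properUr // sub1set.
Qed.

(** Toggling at [p] is an involution of the ideals that reverses the sign of the summand. Hence the
    uniform distribution is toggle-symmetric. *)
Lemma sum_toggleability p : \sum_(I in ideals P) toggleability R p I = 0.
Proof.
apply/eqP; rewrite -[_ == 0](mulrn_eq0 _ 2) mulr2n.
rewrite {1}(reindex_onto (toggle p) (toggle p)) /=; last by move=> I; exact: toggleK.
rewrite (eq_bigl (mem (ideals P))); last first.
  move=> I /=; apply/andP/idP => [[h /eqP <-]|h]; first exact: toggle_ideal.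
  by rewrite toggleK ?toggle_ideal.
rewrite -big_split /= big1 // => I hI; rewrite /toggleability toggleK //.
case: ifP => [h|_]; last by case: ifP => _; rewrite ?addNr ?addr0.
case: ifP => [h'|_]; last by rewrite subrr.
by have := proper_trans h h'; rewrite properxx.
Qed.

Lemma ddegE I : (ddeg I)%:R = \sum_(p : P) (removable p I)%:R :> R.
Proof.
rewrite /ddeg cardE -sum1_size big_enum /= natr_sum big_mkcond /=.
by apply: eq_bigr => p _; rewrite inE /removable; case: ifP.
Qed.

(* A toggle-symmetric signed measure, added to a large multiple of the uniform
   one, normalises to a toggle-symmetric distribution. *)
Lemma tCDE_signed (w : {set P} -> R) :
  tCDE R P -> toggle_symmetric w ->
  expectation w (fun I => (ddeg I)%:R) =
    edge_density R P * \sum_(I in ideals P) w I.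
Proof.
move=> tP wsym.
(* This constant makes every shifted weight at least 1, so the total [S] is positive and dividing by
   it gives a distribution. *)
pose C := 1 + \sum_(I in ideals P) `|w I|.
pose N : R := #|ideals P|%:R.
pose S := \sum_(I in ideals P) w I + C * N.
have wC I : I \in ideals P -> 1 <= w I + C.
  move=> hI; rewrite /C (bigD1 I) //=.
  have : 0 <= \sum_(J in ideals P | J != I) `|w J| by apply: sumr_ge0.
  by have := ler_norm (- w I); rewrite normrN; lra.
have SE : S = \sum_(I in ideals P) (w I + C).
  by rewrite big_split /= sumr_const -mulr_natr.
have N_gt0 : 0 < N by rewrite ltr0n; apply/card_gt0P; exists set0; exact: set0_ideal.
have S_gt0 : 0 < S.
  apply: lt_le_trans N_gt0 _; rewrite SE /N -sum1_card natr_sum.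
  by apply: ler_sum.
pose mu I := (w I + C) / S.
have muE X : expectation mu X = (expectation w X + C * \sum_(I in ideals P) X I) / S.
  rewrite /expectation mulr_sumr -big_split /= mulr_suml.
  by apply: eq_bigr => I _; rewrite /mu -mulrDl mulrAC.
have mu_dist : is_distribution mu.
  split=> [I hI|]; first by rewrite divr_ge0 ?(ltW S_gt0) // (le_trans ler01) ?wC.
  by rewrite -mulr_suml -SE divff ?gt_eqF.
have mu_sym : toggle_symmetric mu.
  by move=> p; rewrite muE wsym sum_toggleability mulr0 addr0 mul0r.
have := tP mu mu_dist mu_sym; rewrite muE /edge_density -/N.
set E := expectation w _; set D := \sum_(I in _) _ => h.
have {}h : E + C * D = D / N * S by rewrite -h mulfVK ?gt_eqF.
have N_neq0 : N != 0 by rewrite gt_eqF.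
by apply: (addIr (C * D)); rewrite h /S; field.
Qed.

End Ideals.

(** * Linearity of expectation *)

Section Expectation.
Variables (R : realType) (d : Order.disp_t) (P : finPOrderType d).
Implicit Types (w X Y : {set P} -> R).

Lemma eq_expectation w X Y :
  {in ideals P, X =1 Y} -> expectation w X = expectation w Y.
Proof. by move=> XY; apply: eq_bigr => I hI; rewrite XY. Qed.

Lemma expectationB w X Y :
  expectation w (fun I => X I - Y I) = expectation w X - expectation w Y.
Proof. by rewrite /expectation -sumrB; apply: eq_bigr => I _; rewrite mulrBr. Qed.

Lemma expectation_sumr (T : Type) (r : seq T) w (X : T -> {set P} -> R) :
  expectation w (fun I => \sum_(i <- r) X i I) = \sum_(i <- r) expectation w (X i).
Proof.
rewrite exchange_big /=; apply: eq_bigr => I _; exact: mulr_sumr.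
Qed.

Lemma expectation_suml (T : Type) (r : seq T) (w : T -> {set P} -> R) X :
  expectation (fun I => \sum_(i <- r) w i I) X = \sum_(i <- r) expectation (w i) X.
Proof.
rewrite exchange_big /=; apply: eq_bigr => I _; exact: mulr_suml.
Qed.

End Expectation.

(* Moebius inversion over a family of sets ordered by inclusion: [w] is built by
   recursion on the size of the complement. *)
Lemma exists_upper_mass (R : realType) (T : finType) (S : {set {set T}})
    (g : {set T} -> R) :
  exists w : {set T} -> R,
    forall I, I \in S -> \sum_(J in S | I \subset J) w J = g I.
Proof.
(* The strict bound is vacuous at 0 and holds for every set at [#|T|.+1]. *)
suff [w hw] : exists w : {set T} -> R, forall I, I \in S ->
    (#|~: I| < #|T|.+1)%N -> \sum_(J in S | I \subset J) w J = g I.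
  by exists w => I IS; apply: hw => //; rewrite ltnS max_card.
elim: #|T|.+1 => [|n [w hw]]; first by exists (fun=> 0).
pose w' I := if #|~: I| == n
  then g I - \sum_(J in S | (I \subset J) && (J != I)) w J else w I.
exists w' => I IS; rewrite ltnS => In.
have hsum : \sum_(J in S | (I \subset J) && (J != I)) w' J =
    \sum_(J in S | (I \subset J) && (J != I)) w J.
  apply: eq_bigr => J /and3P[_ IJ JI]; rewrite /w' ltn_eqF //.
  apply: leq_trans In; apply: proper_card; rewrite properC properEneq.
  by rewrite eq_sym JI.
rewrite (bigD1 I) /=; last by rewrite IS subxx.
under eq_bigl do rewrite -andbA.
rewrite hsum {1}/w'; case: (eqVneq #|~: I| n) => [_|neqn]; first by rewrite subrK.
rewrite -(hw I) //; last by rewrite ltn_neqAle neqn.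
rewrite [RHS](bigD1 I) /=; last by rewrite IS subxx.
by congr (_ + _); apply: eq_bigl => J; rewrite -andbA.
Qed.

(** * Cover sums in the extended poset *)

Section HatCovers.
Variables (d : Order.disp_t) (P : finPOrderType d).
Implicit Types (p q : P).

Lemma hat_ltE p q : (HElt p < HElt q)%O = (p < q)%O.
Proof. by rewrite !lt_neqAle. Qed.

Lemma hat_lt_bot p : (HBot < HElt p :> hat P)%O.
Proof. by []. Qed.

Lemma hat_lt_top p : (HElt p < HTop :> hat P)%O.
Proof. by []. Qed.

Lemma hat_covers p q : covers (HElt p) (HElt q) = covers p q.
Proof.
rewrite /covers hat_ltE; congr (_ && ~~ _); apply/existsP/existsP.
  by case=> -[|z|] // /andP[]; rewrite ?hat_ltE => h1 h2; exists z; rewrite h1.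
by case=> z h; exists (HElt z); rewrite !hat_ltE.
Qed.

Variables (R : realType) (F : hat P -> R).

(** The added bottom is covered by [p] exactly when [p] is minimal in [P]: otherwise any [q] covered
    by [p] lies strictly between them. *)
Lemma sum_lower_covers p :
  \sum_(x : hat P | covers (HElt p) x) F x =
  if [set q | covers p q]%SET == set0 then F HBot
  else \sum_(q in [set q | covers p q]%SET) F (HElt q).
Proof.
case: ifPn => [/eqP h|/set0Pn[q]].
  have minp q : (q < p)%O = false.
    apply/negP => /exists_lower_cover[r rp].
    by have := in_set0 r; rewrite -h inE rp.
  apply: big_pred1 => -[|q|] /=.
  - rewrite eqxx /covers hat_lt_bot /=; apply/existsPn => -[|z|] //.
    by rewrite hat_ltE minp andbF.
  - by rewrite hat_covers /covers minp.
  - by [].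
rewrite inE => qp.
rewrite (reindex_omap (@HElt P) (fun x => if x is HElt q then Some q else None)) /=.
  by apply: eq_bigl => r; rewrite inE hat_covers eqxx andbT.
case=> [|r|] //= /andP[_ /existsPn/(_ (HElt q))].
by rewrite hat_lt_bot hat_ltE; case/andP: qp => ->.
Qed.

Lemma sum_upper_covers p :
  \sum_(x : hat P | covers x (HElt p)) F x =
  if [set q | covers q p]%SET == set0 then F HTop
  else \sum_(q in [set q | covers q p]%SET) F (HElt q).
Proof.
case: ifPn => [/eqP h|/set0Pn[q]].
  have maxp q : (p < q)%O = false.
    apply/negP => /exists_upper_cover[r rp _].
    by have := in_set0 r; rewrite -h inE rp.
  apply: big_pred1 => -[|q|] /=.
  - by [].
  - by rewrite hat_covers /covers maxp.
  - rewrite eqxx /covers hat_lt_top /=; apply/existsPn => -[|z|] //.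
    by rewrite hat_ltE maxp.
rewrite inE => qp.
rewrite (reindex_omap (@HElt P) (fun x => if x is HElt q then Some q else None)) /=.
  by apply: eq_bigl => r; rewrite inE hat_covers eqxx andbT.
case=> [|r|] //= /andP[_ /existsPn/(_ (HElt q))].
by rewrite hat_lt_top hat_ltE; case/andP: qp => ->.
Qed.

End HatCovers.

(** * Birational toggles and rowmotion *)

Section BirationalRowmotion.
Variables (R : realType) (d : Order.disp_t) (P : finPOrderType d).
Variables (alpha omega : R).
Hypotheses (alpha_gt0 : 0 < alpha) (omega_gt0 : 0 < omega).
Implicit Types (f g : {ffun P -> R}) (p q : P).

Let pos := @positive_functions R d P.

Definition lowerB f p : R := \sum_(x : hat P | covers (HElt p) x) hat_ext alpha omega f x.
Definition upperB f p : R :=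
  \sum_(x : hat P | covers x (HElt p)) (hat_ext alpha omega f x)^-1.

(** The birational analogue of the indicator [addable p], dual to [toggleabilityB_minus]. *)
Definition toggleabilityB_plus p f : R := f p / lowerB f p.

Lemma sumr_set_gt0 (A : {set P}) (F : P -> R) :
  A != set0 -> (forall q, 0 < F q) -> 0 < \sum_(q in A) F q.
Proof.
move=> /set0Pn[q qA] F_gt0; rewrite (bigD1 q) //=.
by rewrite ltr_pwDl // sumr_ge0 // => r _; exact: ltW.
Qed.

Lemma lowerB_gt0 f p : pos f -> 0 < lowerB f p.
Proof.
by move=> fpos; rewrite /lowerB sum_lower_covers; case: ifPn => // /sumr_set_gt0; apply.
Qed.

Lemma upperB_gt0 f p : pos f -> 0 < upperB f p.
Proof.
move=> fpos; rewrite /upperB sum_upper_covers; case: ifPn => [_|/sumr_set_gt0].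
  by rewrite invr_gt0.
by move=> h; apply: h => q; rewrite invr_gt0 fpos.
Qed.

Lemma toggleBE p f :
  toggleB alpha omega p f p = (f p)^-1 * (lowerB f p / upperB f p).
Proof. by rewrite ffunE eqxx. Qed.

Lemma toggleB_neq p q f : q != p -> toggleB alpha omega p f q = f q.
Proof. by move=> qp; rewrite ffunE (negbTE qp). Qed.

Lemma eq_lowerB f g p :
  (forall q, (q < p)%O -> f q = g q) -> lowerB f p = lowerB g p.
Proof.
by move=> fg; apply: eq_bigr => -[|q|] //=; rewrite hat_covers => /andP[/fg].
Qed.

Lemma eq_upperB f g p :
  (forall q, (p < q)%O -> f q = g q) -> upperB f p = upperB g p.
Proof.
by move=> fg; apply: eq_bigr => -[|q|] //=; rewrite hat_covers => /andP[/fg ->].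
Qed.

Lemma toggleB_pos p f : pos f -> pos (toggleB alpha omega p f).
Proof.
move=> fpos q; have [->|qp] := eqVneq q p; last by rewrite toggleB_neq.
by rewrite toggleBE mulr_gt0 ?invr_gt0 // divr_gt0 ?lowerB_gt0 ?upperB_gt0.
Qed.

(** The lower and upper sums at [p] involve only other elements, so both toggles use the same ratio
    and the two inversions cancel. *)
Lemma toggleBK p f : pos f -> toggleB alpha omega p (toggleB alpha omega p f) = f.
Proof.
move=> fpos; apply/ffunP => q; have [->|qp] := eqVneq q p; last first.
  by rewrite !toggleB_neq.
rewrite toggleBE (@eq_lowerB _ f); last first.
  by move=> r rp; rewrite toggleB_neq // lt_eqF.
rewrite (@eq_upperB _ f); last by move=> r rp; rewrite toggleB_neq // gt_eqF.
rewrite toggleBE invfM invrK -mulrA mulVf ?mulr1 //.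
by rewrite mulf_neq0 ?invr_neq0 // gt_eqF ?lowerB_gt0 ?upperB_gt0.
Qed.

Lemma rowB_pos s f : pos f -> pos (rowB alpha omega s f).
Proof. by move=> fpos; elim: s => //= p s; exact: toggleB_pos. Qed.

Lemma rowB_inj s f g :
  pos f -> pos g -> rowB alpha omega s f = rowB alpha omega s g -> f = g.
Proof.
move=> fpos gpos; elim: s => //= p s IH eq_s; apply: IH.
by rewrite -(@toggleBK p (rowB _ _ s f)) ?eq_s ?toggleBK //; exact: rowB_pos.
Qed.

Lemma rowB_notin s f q : q \notin s -> rowB alpha omega s f q = f q.
Proof.
elim: s => //= p s IH; rewrite inE negb_or => /andP[qp /IH <-].
exact: toggleB_neq.
Qed.

(* When rowmotion reaches [p], everything above [p] already has its new value
   and everything below still has its old one. *)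
Lemma toggleabilityB_minus_rowB s f p : linear_extension s -> pos f ->
  toggleabilityB_minus alpha omega p (rowB alpha omega s f) =
  toggleabilityB_plus p f.
Proof.
case=> s_uniq s_all s_lt fpos; have ps := s_all p.
(* The toggles of [s2] act before the one at [p], those of [s1] after it. Elements below [p] lie in
   [s1], elements above in [s2]. *)
case: (splitPr ps) s_uniq s_lt => s1 s2 {s s_all ps}.
rewrite cat_uniq /= negb_or => /and3P[_ /andP[ps1 s12] /andP[ps2 _]] s_lt.
set h := rowB alpha omega s2 f.
have hpos : pos h by exact: rowB_pos.
have rowE q : q \notin s1 ->
    rowB alpha omega (s1 ++ p :: s2) f q = toggleB alpha omega p h q.
  by move=> qs1; rewrite /rowB foldr_cat -/(rowB _ _ s1 _) rowB_notin.
have pidx : index p (s1 ++ p :: s2) = size s1.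
  by rewrite index_cat (negbTE ps1) /= eqxx addn0.
have lowE : lowerB h p = lowerB f p.
  apply: eq_lowerB => q qp; apply: rowB_notin; apply/negP => qs2.
  have := s_lt _ _ qp; rewrite pidx index_cat; case: ifP => [qs1|_].
    by move/hasPn: s12 => /(_ q qs2); rewrite /= qs1.
  by rewrite ltnNge leq_addr.
have upE : upperB (rowB alpha omega (s1 ++ p :: s2) f) p = upperB h p.
  apply: eq_upperB => q pq; rewrite rowE ?toggleB_neq ?gt_eqF //.
  apply/negP => qs1; have := s_lt _ _ pq.
  by rewrite pidx index_cat qs1 ltnNge ltnW // index_mem.
rewrite /toggleabilityB_minus -/(upperB _ p) upE rowE // toggleBE lowE.
rewrite /h rowB_notin // -/h /toggleabilityB_plus.
have := fpos p; have := lowerB_gt0 p fpos; have := upperB_gt0 p hpos.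
move=> /lt0r_neq0 h1 /lt0r_neq0 h2 /lt0r_neq0 h3; field.
by rewrite h1 h2 h3.
Qed.

(** The default [alpha] is the value at the added bottom, which stands in for the missing maximal
    element of the empty ideal. With it, the value on [sdown p] is [lowerB f p] even for minimal
    [p]. *)
Definition maximal_sum f (I : {set P}) : R :=
  if maximals I == set0 then alpha else \sum_(q in maximals I) f q.

(* [w] plays the role of a distribution on ideals that [f] comes from: its
   expectations are the logarithms of the birational statistics at [f]. *)
Definition log_lift f (w : {set P} -> R) : Prop :=
  forall I, I \in ideals P ->
    \sum_(J in ideals P | I \subset J) w J = ln omega - ln (maximal_sum f I).

(** An element of [J] above [p] lies above some upper cover of [p], which is then in [J] too.
    Removability thus depends only on membership of [p] and its upper covers. *)
Lemma removable_covers p (J : {set P}) : J \in ideals P ->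
  removable p J = (p \in J) && [forall q in [set q | covers q p]%SET, q \notin J].
Proof.
move=> /idealP hJ; congr (_ && _); apply/forall_inP/forall_inP => h q.
  by rewrite inE => /andP[pq _]; apply/negP => /h; rewrite pq.
move=> qJ; apply/negP => /exists_upper_cover[r rp rq].
by have := h r; rewrite inE rp (hJ q) // => /(_ isT).
Qed.

(** * Expectations under a logarithmic lift *)

Section LogLift.
Variables (f : {ffun P -> R}) (w : {set P} -> R).
Hypotheses (f_pos : pos f) (w_lift : log_lift f w).

Lemma expectation_subset (I : {set P}) : I \in ideals P ->
  expectation w (fun J => (I \subset J)%:R) = ln omega - ln (maximal_sum f I).
Proof.
move=> hI; rewrite -w_lift // /expectation big_mkcondr /=.
by apply: eq_bigr => J _; case: ifP => _; rewrite ?mulr1 ?mulr0.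
Qed.

Lemma expectation_total : \sum_(J in ideals P) w J = ln (omega / alpha).
Proof.
rewrite ln_div ?posrE //.
have := w_lift (set0_ideal P); rewrite /maximal_sum.
have -> : maximals (set0 : {set P}) == set0.
  by apply/eqP/setP => x; rewrite !inE.
by under eq_bigl do rewrite sub0set andbT.
Qed.

Lemma expectation_mem p :
  expectation w (fun J => (p \in J)%:R) = ln omega - ln (f p).
Proof.
rewrite (@eq_expectation _ _ _ _ _ (fun J => (down p \subset J)%:R)); last first.
  by move=> J hJ /=; rewrite down_subE.
rewrite expectation_subset ?down_ideal // /maximal_sum maximals_down.
by rewrite -cards_eq0 cards1 /= big_set1.
Qed.

(** An ideal containing [p] contains [sdown p], so the indicator is a difference of two containment
    indicators, and the two [ln omega] cancel. *)
Lemma expectation_addable p :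
  expectation w (fun J => (addable p J)%:R) =
  ln (toggleabilityB_plus p f).
Proof.
rewrite (@eq_expectation _ _ _ _ _
  (fun J => (sdown p \subset J)%:R - (p \in J)%:R)); last first.
  move=> J /idealP hJ; rewrite /addable.
  case: (boolP (p \in J)) => pJ; rewrite ?subr0 //=.
  suff -> : sdown p \subset J by rewrite subrr.
  by apply/subsetP => x; rewrite inE => /ltW; exact: hJ.
rewrite expectationB expectation_mem expectation_subset ?sdown_ideal //.
have -> : maximal_sum f (sdown p) = lowerB f p.
  by rewrite /maximal_sum maximals_sdown /lowerB sum_lower_covers.
rewrite /toggleabilityB_plus ln_div ?posrE ?f_pos ?lowerB_gt0 //.
by lra.
Qed.

(** Inclusion-exclusion over the upper covers of [p], by cases on whether there are none, one or
    two. *)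
Lemma expectation_removable p : (#|[set q | covers q p]%SET| <= 2)%N ->
  expectation w (fun J => (removable p J)%:R) =
  ln (toggleabilityB_minus alpha omega p f).
Proof.
move=> card_le2; rewrite /toggleabilityB_minus -/(upperB f p).
rewrite lnM ?posrE ?invr_gt0 ?f_pos ?upperB_gt0 // !lnV ?posrE ?f_pos ?upperB_gt0 //.
rewrite /upperB sum_upper_covers.
have [A0|[q A1]|[q [r [qr A2]]]] : [\/ [set q | covers q p] = set0,
    exists q, [set q | covers q p] = [set q] |
    exists q r, q != r /\ [set q | covers q p] = [set q; r]].
- move: card_le2; rewrite leq_eqVlt ltnS leq_eqVlt ltnS leqn0.
  case/or3P => [/cards2P[q [r]]|/cards1P|]; [|by constructor 2|].
    by constructor 3; exists q, r.
  by rewrite cards_eq0 => /eqP; constructor 1.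
- rewrite A0 eqxx (@eq_expectation _ _ _ _ _ (fun J => (p \in J)%:R)); last first.
    move=> J hJ /=; rewrite removable_covers // A0.
    suff -> : [forall q in set0, q \notin J] by rewrite andbT.
    by apply/forall_inP => q; rewrite inE.
  by rewrite expectation_mem /= lnV ?posrE //; lra.
- have qp : covers q p by have := set11 q; rewrite -A1 inE.
  rewrite A1 -cards_eq0 cards1 big_set1 /= lnV ?posrE ?f_pos //.
  rewrite (@eq_expectation _ _ _ _ _ (fun J => (p \in J)%:R - (q \in J)%:R)).
    by rewrite expectationB !expectation_mem; lra.
  move=> J hJ /=; rewrite removable_covers // A1.
  have -> : [forall q0 in [set q], q0 \notin J] = (q \notin J).
    apply/forall_inP/idP => [|h x]; first by apply; rewrite inE.
    by rewrite inE => /eqP ->.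
  case: (boolP (q \in J)) => qJ; rewrite ?andbT ?subr0 //=.
  have /idealP/(_ q p qJ) -> := hJ; first by rewrite subrr.
  by case/andP: qp => /ltW.
- have qp : covers q p by have := set21 q r; rewrite -A2 inE.
  have rp : covers r p by have := set22 q r; rewrite -A2 inE.
  rewrite A2 -cards_eq0 cards2 qr /= big_setU1 ?inE //= big_set1.
  (* The numerator is the maximal sum of [down q :|: down r], so the logarithm splits into the terms
     of inclusion-exclusion. *)
  have -> : (f q)^-1 + (f r)^-1 = (f q + f r) / (f q * f r).
    by field; rewrite !gt_eqF ?f_pos.
  rewrite ln_div ?posrE ?addr_gt0 ?mulr_gt0 ?f_pos // lnM ?posrE ?f_pos //.
  rewrite (@eq_expectation _ _ _ _ _ (fun J => ((p \in J)%:R - (q \in J)%:R) -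
    ((r \in J)%:R - (down q :|: down r \subset J)%:R))).
    rewrite !expectationB !expectation_mem expectation_subset; last first.
      by rewrite setU_ideal ?down_ideal.
    rewrite /maximal_sum (maximals_downU qp rp) -cards_eq0 cards2 qr /=.
    by rewrite big_setU1 ?inE //= big_set1; lra.
  move=> J hJ /=; rewrite removable_covers // A2 subUset !down_subE //.
  have -> : [forall x in [set q; r], x \notin J] = (q \notin J) && (r \notin J).
    apply/forall_inP/andP => [h|[hq hr] x]; first by rewrite !h ?inE ?eqxx ?orbT.
    by rewrite !inE => /orP[] /eqP ->.
  have pJ x : x \in J -> covers x p -> p \in J.
    by move=> xJ /andP[/ltW px _]; move/idealP: hJ => /(_ x p xJ px).
  case: (boolP (p \in J)) => [_|pNJ] /=.
    by case: (q \in J); case: (r \in J); rewrite /= ?(subrr, subr0).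
  have notin x : covers x p -> (x \in J) = false.
    by move=> xp; apply/negP => /pJ/(_ xp); exact/negP.
  by rewrite !notin //= ?(subrr, subr0).
Qed.

End LogLift.

Lemma exists_log_lift f : exists w, log_lift f w.
Proof. exact: exists_upper_mass. Qed.

End BirationalRowmotion.

(** * Summation over a finite orbit *)

Lemma big_seq_bij (T : eqType) (R : nmodType) (r : seq T) (h : T -> T) (F : T -> R) :
  uniq r -> {in r &, injective h} -> {in r, forall x, h x \in r} ->
  \sum_(x <- r) F (h x) = \sum_(x <- r) F x.
Proof.
move=> r_uniq h_inj h_r; rewrite -(big_map h xpredT F); apply: perm_big.
have hr_uniq : uniq (map h r) by rewrite map_inj_in_uniq.
have hr_sub : {subset map h r <= r} by move=> _ /mapP[x xr ->]; exact: h_r.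
(* The image is duplicate-free, contained in [r] and of the same size, hence a permutation of
   [r]. *)
have [//|_ ?] := uniq_min_size hr_uniq hr_sub; first by rewrite size_map.
exact: uniq_perm.
Qed.

Lemma ln_prod (R : realType) (T : Type) (r : seq T) (Q : pred T) (F : T -> R) :
  (forall x, Q x -> 0 < F x) ->
  ln (\prod_(x <- r | Q x) F x) = \sum_(x <- r | Q x) ln (F x).
Proof.
move=> F_gt0; elim: r => [|x r IH]; first by rewrite !big_nil ln1.
rewrite !big_cons; case: ifP => // Qx.
by rewrite lnM ?posrE ?prodr_gt0 ?F_gt0 // IH.
Qed.

Theorem theorem4p43 (R : realType) (d : Order.disp_t) (P : finPOrderType d)
  (covers_le2 : forall p : P, (#|[set q : P | covers p q]%SET| <= 2)%N)
  (covered_le2 : forall p : P, (#|[set q : P | covers q p]%SET| <= 2)%N)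
  (delta : R) (tCDE_P : tCDE R P) (delta_def : edge_density R P = delta)
  (alpha omega : R) (alpha_gt0 : 0 < alpha) (omega_gt0 : 0 < omega)
  (s : seq P) (s_linext : linear_extension s)
  (O : set {ffun P -> R})
  (O_orbit : is_orbit (@positive_functions R d P) (rowB alpha omega s) O)
  (O_fin : finite_set O) :
  \prod_(f <- fset_set O) ddegB alpha omega f
    = powR (omega / alpha) (delta * (#|` fset_set O|)%:R).
Proof.
set row := rowB alpha omega s in O_orbit.
have [w w_lift] := choice (exists_log_lift (P := P) alpha omega).
have O_pos f : f \in fset_set O -> positive_functions f.
  by rewrite in_fset_set // => /set_mem; case: O_orbit => x _ -> [].
have row_O f : f \in fset_set O -> row f \in fset_set O.
  rewrite !in_fset_set // => /set_mem; case: O_orbit => x x_pos -> [f_pos [n fx]].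
  apply/mem_set; split; first exact: rowB_pos.
  case: fx => [->|]; first by exists n.+1; left.
  (* If [f] reaches [x] in [n] steps, [row f] needs one step fewer; for [n] zero, [f] is [x] and
     [row f] is one step forward. *)
  case: n => [->|n ->]; first by exists 1%N; left.
  by exists n; right; rewrite iterSr.
pose W I := \sum_(f <- fset_set O) w f I.
have W_sym : toggle_symmetric W.
  move=> p; rewrite expectation_suml.
  rewrite (eq_big_seq (fun f => ln (toggleabilityB_plus alpha omega p f) -
      ln (toggleabilityB_minus alpha omega p f))); last first.
    move=> f /O_pos f_pos.
    rewrite -(expectation_addable alpha_gt0 f_pos (w_lift f)).
    rewrite -(expectation_removable omega_gt0 f_pos (w_lift f)) //.
    by rewrite -expectationB; apply: eq_expectation => I; exact: toggleabilityE.
  rewrite sumrB; apply/eqP; rewrite subr_eq0; apply/eqP.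
  (* Rowmotion permutes the orbit, so the removability terms may be taken at [row f], where they
     equal the addability terms at [f]. *)
  rewrite -(@big_seq_bij _ _ _ row (fun f => ln (toggleabilityB_minus _ _ p f))).
  - apply: eq_big_seq => f /O_pos f_pos; congr ln.
    by rewrite toggleabilityB_minus_rowB.
  - exact: fset_uniq.
  - by move=> f g /O_pos f_pos /O_pos g_pos; exact: rowB_inj.
  - exact: row_O.
have minus_gt0 (f : {ffun P -> R}) p : positive_functions f ->
    0 < toggleabilityB_minus alpha omega p f.
  by move=> f_pos; rewrite mulr_gt0 // invr_gt0 ?upperB_gt0 ?f_pos.
have ddegB_gt0 (f : {ffun P -> R}) : positive_functions f -> 0 < ddegB alpha omega f.
  by move=> f_pos; apply: prodr_gt0 => p _; exact: minus_gt0.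
have W_ddeg : expectation W (fun I => (ddeg I)%:R) =
    \sum_(f <- fset_set O) ln (ddegB alpha omega f).
  rewrite expectation_suml; apply: eq_big_seq => f /O_pos f_pos.
  rewrite ln_prod; last by move=> p _; exact: minus_gt0.
  rewrite (@eq_expectation _ _ _ _ _ (fun I => \sum_(p : P) (removable p I)%:R)).
    rewrite expectation_sumr; apply: eq_bigr => p _.
    by rewrite (expectation_removable omega_gt0 f_pos (w_lift f)).
  by move=> I _; exact: ddegE.
have W_total : \sum_(I in ideals P) W I = #|` fset_set O|%:R * ln (omega / alpha).
  rewrite exchange_big /=.
  under eq_bigr do rewrite (expectation_total alpha_gt0 omega_gt0 (w_lift _)).
  by rewrite big_const_seq count_predT iter_addr_0 mulr_natl.
have := tCDE_signed tCDE_P W_sym.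
rewrite W_ddeg W_total delta_def mulrA => lnE.
(* For a nonzero base [powR] is the exponential of the exponent times the logarithm; [big_seq] keeps
   orbit membership at hand for positivity. *)
rewrite /powR gt_eqF ?divr_gt0 // -lnE [in RHS]big_seq.
rewrite -ln_prod; last by move=> f /O_pos; exact: ddegB_gt0.
by rewrite -big_seq lnK // posrE big_seq prodr_gt0 // => f /O_pos; exact: ddegB_gt0.
Qed.
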